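(* Let $M$ be a binary matroid and let $M'$ be a binary matroidal retract of $M$. Then $M'$ is a matroidal retract of $M$.
   Context: Throughout, matroids are finite and non-free (they have at least one circuit). A matroid is binary if it is representable over $\mathbb{F}_2$. A cycle of $M$ is a disjoint union of (possibly zero) circuits; $\mathrm{Cyc}(M)$ is the set of cycles; $\chi_C$ denotes the characteristic vector of $C$ in $\{0,1\}^{E(M)}$. Binary matroidal retract: let $M$ be binary and let $E=\{e_1,\dots,e_s\}$, $E'=\{e'_1,\dots,e'_s\}$ ($s\ge1$) be disjoint subsets of $E(M)$ of size $s$ such that (a) $E'$ is a circuit of $M$; (b) for every circuit $C$ of $M$, every $p\in\{0,\dots,s-1\}$ and indices $i_1,\dots,i_p$, one has $C\cap E'=\{e'_{i_1},\dots,e'_{i_p}\}$ if and only if either $C\cap E=\{e_{i_1},\dots,e_{i_p}\}$ or $C\cap E=E-\{e_{i_1},\dots,e_{i_p}\}$. Then the contraction $M/E'$ is called a binary matroidal retract of $M$. Matroidal retract: for matroids $M,M'$ with $E(M')\subseteq E(M)$, $M'$ is a matroidal retract of $M$ if there exist maps $\lambda:\mathrm{Cyc}(M')\to\mathrm{Cyc}(M)$ and $\pi:\mathrm{Cyc}(M)\to\mathrm{Cyc}(M')$ such that (a) $\pi\circ\lambda=\mathrm{id}_{\mathrm{Cyc}(M')}$; (b) whenever $\sum_{i=1}^d\chi_{C'_i}=\sum_{i=1}^d\chi_{D'_i}$ with $C'_i,D'_i\in\mathrm{Cyc}(M')$, $d\ge1$, then $\sum_i\chi_{\lambda(C'_i)}=\sum_i\chi_{\lambda(D'_i)}$;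 (c) whenever $\sum_{i=1}^d\chi_{C_i}=\sum_{i=1}^d\chi_{D_i}$ with $C_i,D_i\in\mathrm{Cyc}(M)$, $d\ge1$, then $\sum_i\chi_{\pi(C_i)}=\sum_i\chi_{\pi(D_i)}$.
   Formalization: In condition (b) the ''if and only if'' can never hold (take C = E', p = 0: C∩E is empty but C∩E' is not); it is replaced by the implication from C∩E' = {e'_i1,…,e'_ip} to C∩E = {e_i1,…,e_ip} or its complement in E, a weaker assumption. *)

(* Defs.v *)
From mathcomp Require Import all_boot all_order all_algebra.

Set Implicit Arguments.
Unset Strict Implicit.
Unset Printing Implicit Defensive.

Import GRing.Theory.

(* The ground set is a subset of an ambient finite type, so that a matroid and
   its minors live over the same type. *)
Record matroid (T : finType) := Matroid {
  ground : {set T};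
  indep : {set {set T}};
  indep_ground : forall I : {set T}, I \in indep -> I \subset ground;
  indep0 : set0 \in indep;
  indep_sub : forall I J : {set T}, I \subset J -> J \in indep -> I \in indep;
  indep_aug : forall I J : {set T}, I \in indep -> J \in indep -> #|I| < #|J| ->
    exists2 x, x \in J :\: I & x |: I \in indep
}.

Section Basics.
Variables (T : finType) (M : matroid T).
Implicit Types (B C D I X : {set T}).

Definition circuit C :=
  minset (fun D => (D \subset ground M) && (D \notin indep M)) C.

Definition nonfree := exists C, circuit C.

Definition cycle C :=
  [exists P : {set {set T}},
    [&& [forall D in P, circuit D], trivIset P & cover P == C]].

Definition Cyc := {C : {set T} | cycle C}.

(* [free] is applied to a sequence, so equal vectors attached to distinct
   elements count as dependent. *)
Definition representable (F : fieldType) :=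
  exists (n : nat) (v : T -> 'rV[F]_n),
    forall I, I \subset ground M ->
      (I \in indep M) = free [seq v x | x <- enum I].

Definition binary := representable 'F_2.

Definition basis_in X B :=
  maxset (fun D => (D \subset X) && (D \in indep M)) B.

Lemma circuit_sub C : circuit C -> C \subset ground M.
Proof. by case/minsetP=> /andP[]. Qed.

Lemma circuit_neq0 C : circuit C -> C != set0.
Proof.
by case/minsetP=> /andP[_ nC] _; apply: contra nC => /eqP->; apply: indep0.
Qed.

Lemma circuit_min C D : circuit C -> circuit D -> D \subset C -> D = C.
Proof. by case/minsetP=> _ minC /minsetP[dD _]; apply: minC. Qed.

Lemma basis_in_max X B x :
  basis_in X B -> x \in X -> x |: B \in indep M -> x \in B.
Proof.
case/maxsetP=> /andP[sBX _] maxB xX ixB.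
by rewrite -(maxB (x |: B)) ?setU11 ?subsetUr // subUset sub1set xX sBX.
Qed.

Lemma basis_in_card X B1 B2 : basis_in X B1 -> basis_in X B2 -> #|B2| <= #|B1|.
Proof.
move=> b1 b2; rewrite leqNgt; apply/negP=> lt12.
have /maxsetP[/andP[_ i1] _] := b1; have /maxsetP[/andP[s2 i2] _] := b2.
have [x /setDP[x2 /negP nx1] ix] := indep_aug i1 i2 lt12.
by apply: nx1; apply: basis_in_max b1 _ ix; apply: (subsetP s2).
Qed.

End Basics.

Section Contraction.
Variables (T : finType) (M : matroid T) (X : {set T}).
Implicit Types (B I J : {set T}).

Definition contract_indep : {set {set T}} :=
  [set I : {set T} | (I \subset ground M :\: X)
     && [exists B : {set T}, basis_in M X B && (I :|: B \in indep M)]].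

Lemma contract_ground I : I \in contract_indep -> I \subset ground M :\: X.
Proof. by rewrite inE => /andP[]. Qed.

Lemma contract_indep0 : set0 \in contract_indep.
Proof.
rewrite inE sub0set /=.
have [|B mB _] := @maxset_exists _
  (fun D => (D \subset X) && (D \in indep M)) set0.
  by rewrite sub0set indep0.
apply/existsP; exists B; rewrite set0U /basis_in mB /=.
by case/maxsetP: mB => /andP[].
Qed.

Lemma contract_sub I J :
  I \subset J -> J \in contract_indep -> I \in contract_indep.
Proof.
move=> sIJ; rewrite !inE => /andP[sJ /existsP[B /andP[bB iJB]]].
rewrite (subset_trans sIJ sJ); apply/existsP; exists B; rewrite bB.
by apply: indep_sub iJB; apply: setSU.
Qed.

Lemma contract_aug I J :
  I \in contract_indep -> J \in contract_indep -> #|I| < #|J| ->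
  exists2 x, x \in J :\: I & x |: I \in contract_indep.
Proof.
rewrite !inE => /andP[sI /existsP[B1 /andP[b1 i1]]].
case/andP=> sJ /existsP[B2 /andP[b2 i2]] ltIJ.
have disjX (K B : {set T}) : K \subset ground M :\: X -> basis_in M X B -> K :&: B = set0.
  move=> sK /maxsetP[/andP[sB _] _]; apply/setP=> y; rewrite !inE.
  apply/negP=> /andP[/(subsetP sK)/setDP[_ /negP nX] /(subsetP sB)].
  exact: nX.
have lt12 : #|I :|: B1| < #|J :|: B2|.
  rewrite !cardsU (disjX _ _ sI b1) (disjX _ _ sJ b2) cards0 !subn0.
  have -> : #|B1| = #|B2|.
    by apply/eqP; rewrite eqn_leq (basis_in_card b2 b1) (basis_in_card b1 b2).
  by rewrite ltn_add2r.
have [x] := indep_aug i1 i2 lt12.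
rewrite !inE negb_or => /andP[/andP[nxI nxB1] xJB] ix.
have xJ : x \in J.
  case/orP: xJB => // xB2; case/negP: nxB1.
  apply: (basis_in_max b1).
    by case/maxsetP: b2 => /andP[/subsetP sB2 _] _; apply: sB2.
  by apply: indep_sub ix; rewrite setUS // subsetUr.
exists x; first by rewrite !inE nxI.
rewrite inE subUset sub1set (subsetP sJ) // sI /=.
by apply/existsP; exists B1; rewrite b1 -setUA.
Qed.

Definition contract : matroid T :=
  Matroid contract_ground contract_indep0 contract_sub contract_aug.

End Contraction.

Section BinaryRetract.
Variables (T : finType) (M : matroid T).

(* [e] and [e'] enumerate E and E'; a set [I] of indices of size p < s stands
   for {i_1, ..., i_p}.

   The source has "if and only if" in place of the last
   implication. Taken literally (see [retract_pair_iff]), this is never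
   satisfied: the circuit E' itself, with p = 0, violates the converse; and for
   0 < p < s and C :&: E = e @: I the converse, applied to I and to its
   complement, would force C :&: E' to be both e' @: I and e' @: ~: I. What is meant is that C :&: E
   and C :&: E' correspond up to complementation; [retract_pairE] shows that
   this is exactly the implication below. *)
Definition retract_pair (s : nat) (e e' : 'I_s -> T) : Prop :=
  let E := e @: setT in
  let E' := e' @: setT in
  [/\ [/\ 0 < s, injective e & injective e'],
      [/\ E \subset ground M, E' \subset ground M & [disjoint E & E']],
      circuit M E'
    & forall (C : {set T}) (I : {set 'I_s}), circuit M C -> #|I| < s ->
        C :&: E' = e' @: I ->
        C :&: E = e @: I \/ C :&: E = E :\: e @: I].

Definition binary_matroidal_retract (M' : matroid T) : Prop :=
  exists (s : nat) (e e' : 'I_s -> T),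
    retract_pair e e' /\ M' = contract M (e' @: setT).

Definition retract_pair_iff (s : nat) (e e' : 'I_s -> T) : Prop :=
  let E := e @: setT in
  let E' := e' @: setT in
  [/\ [/\ 0 < s, injective e & injective e'],
      [/\ E \subset ground M, E' \subset ground M & [disjoint E & E']],
      circuit M E'
    & forall (C : {set T}) (I : {set 'I_s}), circuit M C -> #|I| < s ->
        C :&: E' = e' @: I <->
        (C :&: E = e @: I \/ C :&: E = E :\: e @: I)].

Lemma retract_pair_iff_weaken s (e e' : 'I_s -> T) :
  retract_pair_iff e e' -> retract_pair e e'.
Proof.
by case=> h1 h2 h3 h4; split=> // C I cC ltI; case: (h4 C I cC ltI).
Qed.

Lemma retract_pair_iff_absurd s (e e' : 'I_s -> T) : ~ retract_pair_iff e e'.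
Proof.
case=> [[s_gt0 _ _] [_ _ dis] cE' h].
have [|_ h0] := h _ set0 cE'; first by rewrite cards0.
move: (circuit_neq0 cE') h0; rewrite setIid !imset0 => /eqP nz h0.
by apply: nz; apply: h0; left; rewrite setIC; apply: disjoint_setI0.
Qed.

Lemma retract_pairE s (e e' : 'I_s -> T) :
  retract_pair e e' <->
  [/\ [/\ 0 < s, injective e & injective e'],
      [/\ e @: setT \subset ground M, e' @: setT \subset ground M
        & [disjoint e @: setT & e' @: setT]],
      circuit M (e' @: setT)
    & forall (C : {set T}) (I : {set 'I_s}), circuit M C -> #|I| < s ->
        (C :&: e' @: setT = e' @: I \/
         C :&: e' @: setT = e' @: setT :\: e' @: I) <->
        (C :&: e @: setT = e @: I \/
         C :&: e @: setT = e @: setT :\: e @: I)].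
Proof.
have imC (f : 'I_s -> T) (K : {set 'I_s}) : injective f ->
    f @: setT :\: f @: K = f @: ~: K.
  move=> fI; apply/setP=> y; apply/setDP/imsetP => [[/imsetP[i _ ->] nK]|[i]].
    by exists i; rewrite ?inE //; apply: contra nK; apply: imset_f.
  by rewrite inE => nK ->; rewrite imset_f ?inE // mem_imset.
have ltT (K : {set 'I_s}) : (#|K| < s) = (K != setT).
  by rewrite eqEcard subsetT cardsT card_ord /= -ltnNge.
split=> [] [[s0 eI e'I] [sE sE' dis] cE' h]; split=> // C I cC ltI; last first.
  by move=> hI; apply/h => //; left.
have full : C :&: e' @: setT = e' @: setT -> C :&: e @: setT = set0.
  move/setIidPr=> sC; rewrite -(circuit_min cC cE' sC) setIC.
  exact: disjoint_setI0.
split=> [[/h|hC]|hC]; first exact.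
  have [I0|nI0] := eqVneq I set0.
    by left; rewrite I0 imset0; apply: full; rewrite hC I0 imset0 setD0.
  have ltC : #|~: I| < s.
    by rewrite ltT; apply: contra nI0 => /eqP hI; rewrite -(setCK I) hI setCT.
  have [||] := h C (~: I) cC ltC; first by rewrite hC imC.
    by rewrite imC //; right.
  by rewrite imC // setCK; left.
pose J := [set i | e' i \in C].
have CJ : C :&: e' @: setT = e' @: J.
  apply/setP=> y; apply/setIP/imsetP=> [[yC /imsetP[i _ yi]]|[i]].
    by exists i; rewrite ?inE -?yi.
  by rewrite inE => iC ->; rewrite iC imset_f.
rewrite imC // CJ.
have [JT|nJT] := eqVneq J setT.
  have C0 : C :&: e @: setT = set0 by apply: full; rewrite CJ JT.
  case: hC; rewrite ?imC // C0 => /esym/eqP; rewrite imset_eq0 => /eqP hI.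
    by right; rewrite JT hI setC0.
  by move: ltI; rewrite ltT -(setCK I) hI setC0 eqxx.
have ltJ : #|J| < s by rewrite ltT.
have einj : injective (fun K : {set 'I_s} => e @: K) := imset_inj eI.
have := h C J cC ltJ CJ; rewrite imC // => hJ; rewrite !imC // in hC.
case: hC hJ => -> [] /einj hIJ.
- by left; rewrite hIJ.
- by right; rewrite hIJ setCK.
- by right; rewrite hIJ.
- by left; rewrite -(setCK I) hIJ setCK.
Qed.

End BinaryRetract.

(* Characteristic vectors live in Z^T; those of subsets of a ground set vanish
   off it, so comparing sums over T or over the ground set is the same. *)
Definition charv (T : finType) (C : {set T}) : {ffun T -> int} :=
  [ffun x => (x \in C)%:R%R].

Definition preserves_relations (T : finType) (M N : matroid T)
    (f : Cyc M -> Cyc N) : Prop :=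
  forall (d : nat) (C D : 'I_d -> Cyc M), 0 < d ->
    (\sum_(i < d) charv (val (C i)) = \sum_(i < d) charv (val (D i)))%R ->
    (\sum_(i < d) charv (val (f (C i))) =
     \sum_(i < d) charv (val (f (D i))))%R.

Definition matroidal_retract (T : finType) (M M' : matroid T) : Prop :=
  ground M' \subset ground M /\
  exists (lambda : Cyc M' -> Cyc M) (pi : Cyc M -> Cyc M'),
    [/\ cancel lambda pi, preserves_relations lambda & preserves_relations pi].

(* Main.v *)
(** The cycles of a binary matroid form a family [Z] closed under symmetric
    difference, a set being independent iff it contains no nonempty member of
    [Z]; the sets [C :\: X], for [C] in [Z], play the same role for the
    contraction by [X].  The retract condition on circuits extends additively to
    cycles: the traces of a cycle on E and E' agree up to complementation.  Hence
    a cycle [D] of M/E' lifts to exactly one cycle of M whose trace on E' equals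
    that of [D] on E (the other lift differs by E').  This lift and the
    projection [C :\: E'] are given coordinatewise, so they preserve relations
    between characteristic vectors. *)

From mathcomp Require Import all_boot all_order all_algebra.
Require Import Defs.

Set Implicit Arguments.
Unset Strict Implicit.
Unset Printing Implicit Defensive.

Import GRing.Theory.

(** * Addition of sets modulo 2, and induction on cycles *)

Section SymmetricDifference.
Variable T : finType.
Implicit Types (A B C : {set T}).

Definition symdiff A B := [set x | (x \in A) (+) (x \in B)].

Lemma disjoint_in_setU A B x :
  [disjoint A & B] -> (x \in A :|: B) = (x \in A) (+) (x \in B).
Proof.
move=> dAB; rewrite inE; have [xA|//] := boolP (x \in A).
by rewrite (disjointFr dAB xA).
Qed.

Lemma symdiff_disjoint A B : [disjoint A & B] -> symdiff A B = A :|: B.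
Proof. by move=> dAB; apply/setP=> x; rewrite inE disjoint_in_setU. Qed.

Lemma symdiff_sub A B : B \subset A -> symdiff A B = A :\: B.
Proof.
move=> /subsetP sBA; apply/setP=> x; rewrite !inE.
by have [/sBA->|_] := boolP (x \in B); rewrite ?addbF.
Qed.

End SymmetricDifference.

(** Induction on the number of circuits in a decomposition, peeling off one circuit at a time. *)
Lemma cycle_ind (T : finType) (M : matroid T) (Q : {set T} -> Prop) :
    Q set0 ->
    (forall C K, circuit M C -> Q K -> [disjoint C & K] -> Q (C :|: K)) ->
  forall C, cycle M C -> Q C.
Proof.
move=> Q0 QU C /existsP[P /and3P[/forall_inP cP tP /eqP<-]].
have [n] := ubnP #|P|; elim: n P cP tP => // n IHn P cP tP ltPn.
have [->|[A AP]] := set_0Vmem P; first by rewrite /cover big_set0.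
have sPA : P :\ A \subset P by apply: subD1set.
have -> : cover P = A :|: cover (P :\ A) by rewrite /cover (big_setD1 A).
apply: QU; first exact: cP.
  apply: IHn => [B /(subsetP sPA)/cP //||]; first exact: trivIsetS tP.
  by move: ltPn; rewrite (cardsD1 A P) AP.
rewrite /cover bigcup_disjoint // => B /setD1P[nBA BP].
by move/trivIsetP: tP; apply; rewrite // eq_sym.
Qed.

(** * Cycle spaces and their behaviour under contraction *)

Section CycleSpace.
Variable T : finType.
Implicit Types (M : matroid T) (Z : {set {set T}}) (A B C D I X : {set T}).

(** Binarity in terms of sets instead of vectors: [Z] is a subspace over the two-element field whose
    nonempty members detect dependence. In this form it passes to contractions by taking images. *)
Definition cycle_space M Z : Prop :=
  [/\ set0 \in Z,
      forall A B, A \in Z -> B \in Z -> symdiff A B \in Z,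
      forall A, A \in Z -> A \subset ground M
    & forall I, I \subset ground M ->
        I \in indep M <-> (forall C, C \in Z -> C \subset I -> C = set0)].

Lemma dep_cycle_space M Z I :
    cycle_space M Z -> I \subset ground M -> I \notin indep M ->
  exists2 C, C \in Z & C \subset I /\ C != set0.
Proof.
case=> _ _ _ hI sI nI.
have [/existsP[C /and3P[*]]|] :=
  boolP [exists C : {set T}, [&& C \in Z, C \subset I & C != set0]].
  by exists C.
rewrite negb_exists => /forallP noC; case/negP: nI; apply/hI => // C CZ sC.
by apply/eqP; move: (noC C); rewrite CZ sC negbK.
Qed.

(** Nonempty members of [Z] are dependent and every dependent set contains one, so both families
    have the same minimal sets. *)
Lemma circuit_cycle_space M Z C : cycle_space M Z ->
  circuit M C = minset (fun D => (D \in Z) && (D != set0)) C.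
Proof.
move=> cs; have [_ _ gZ hI] := cs.
have depZ D : D \in Z -> D != set0 -> D \notin indep M.
  move=> DZ; apply: contra => /(hI _ (gZ _ DZ)) /(_ D DZ) h.
  by rewrite h.
apply/minsetP/minsetP=> [[/andP[sC nC] minC]|[/andP[CZ C0] minC]].
  have [D DZ [sDC D0]] := dep_cycle_space cs sC nC.
  have DC : D = C by apply: minC => //; rewrite gZ ?depZ.
  rewrite -{1 2}DC DZ D0; split=> // B /andP[BZ B0].
  by apply: minC; rewrite gZ ?depZ.
split=> [|D /andP[sD nD] sDC]; first by rewrite gZ ?depZ.
have [B BZ [sBD B0]] := dep_cycle_space cs sD nD.
have BC : B = C by apply: minC; rewrite ?BZ ?(subset_trans sBD).
by apply/eqP; rewrite eqEsubset sDC -BC.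
Qed.

(** For the converse, a minimal nonempty member [A] of [Z] inside [C] is a circuit, and [C :\: A] is
    a smaller member of [Z]. *)
Lemma cycle_in_cycle_space M Z C : cycle_space M Z -> cycle M C = (C \in Z).
Proof.
move=> cs; have [Z0 ZD gZ hI] := cs; apply/idP/idP.
  elim/cycle_ind: C / => // C K.
  rewrite (circuit_cycle_space _ cs) => /minsetP[/andP[CZ _] _] KZ dCK.
  by rewrite -symdiff_disjoint // ZD.
have [n] := ubnP #|C|; elim: n C => // n IHn C ltCn CZ.
have [->|C0] := eqVneq C set0.
  apply/existsP; exists set0; rewrite /cover big_set0 eqxx andbT.
  apply/andP; split; first by apply/forall_inP=> D; rewrite inE.
  by apply/trivIsetP=> A B; rewrite inE.
have [|A minA sAC] :=
    @minset_exists _ (fun D => (D \in Z) && (D != set0)) C.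
  by rewrite CZ.
have /minsetP[/andP[AZ A0] _] := minA.
have /existsP[P /and3P[/forall_inP cP tP /eqP coP]] : cycle M (C :\: A).
  apply: IHn; last by rewrite -symdiff_sub // ZD.
  rewrite -ltnS (leq_trans _ ltCn) // ltnS cardsDS //.
  by rewrite ltn_subrL !card_gt0 A0 C0.
have dAP B : B \in P -> [disjoint A & B].
  move=> BP; have sB : B \subset C :\: A by rewrite -coP; apply: bigcup_sup.
  rewrite disjoint_sym; apply: disjointWl sB _.
  by rewrite -setI_eq0 setIDAC -setIDA setDv setI0.
have cA : circuit M A by rewrite (circuit_cycle_space _ cs).
(* This keeps [A] out of [P]: a member disjoint from itself would be empty. *)
have P0 : set0 \notin P by apply/negP=> /cP/circuit_neq0; rewrite eqxx.
have [tAP nAP] := trivIsetU1 dAP tP P0.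
apply/existsP; exists (A |: P); apply/and3P; split=> //.
  by apply/forall_inP=> B /setU1P[->|/cP].
by rewrite /cover big_setU1 //= -/(cover P) coP -{1}(setIidPr sAC) setID.
Qed.

(** Reduction by fundamental circuits of [B]: for [x] in [C :&: X] outside [B], adding a member of
    [Z] inside [x |: B] removes [x] and changes nothing off [X]. *)
Lemma cycle_space_clear M Z X B C : cycle_space M Z ->
    X \subset ground M -> basis_in M X B -> C \in Z ->
  exists2 D, D \in Z & D :\: X = C :\: X /\ D :&: X \subset B.
Proof.
move=> cs sX bB; have [_ ZD _ hI] := cs.
have /maxsetP[/andP[sBX iB] _] := bB.
have [n] := ubnP #|(C :&: X) :\: B|; elim: n C => // n IHn C ltCn CZ.
have [/eqP|[x]] := set_0Vmem ((C :&: X) :\: B).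
  by rewrite setD_eq0; exists C.
case/setDP=> /setIP[xC xX] xB.
have sxB : x |: B \subset X by rewrite subUset sub1set xX.
have sxBg := subset_trans sxB sX.
have [|F FZ [sF F0]] := dep_cycle_space cs sxBg.
  by apply: contra xB => /(basis_in_max bB xX).
(* Otherwise [F] would be a nonempty member of [Z] inside the independent set [B]. *)
have xF : x \in F.
  apply: contraR F0 => xF; apply/eqP.
  have /hI indB := subset_trans sBX sX; apply: (indB.1 iB) => //.
  by rewrite -(setU1K xB) subsetD1 sF.
have sFX := subset_trans sF sxB.
have [||D DZ [eqD sD]] := IHn (symdiff C F); [|exact: ZD|].
  rewrite -ltnS (leq_trans _ ltCn) // ltnS; apply: proper_card.
  apply/properP; split; last by exists x; rewrite !inE ?xC ?xF ?xX ?xB.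
  apply/subsetP=> y; rewrite !inE => /and3P[yB yCF yX].
  rewrite yB yX andbT /=; case: (boolP (y \in F)) yCF => [yF|_]; last first.
    by rewrite addbF.
  by move/(subsetP sF): yF; rewrite !inE (negPf yB) orbF => /eqP->.
exists D => //; split=> //; rewrite eqD; apply/setP=> y; rewrite !inE.
have [//|yX] := boolP (y \in X).
by rewrite (contraNF (subsetP sFX y) yX) addbF.
Qed.

Lemma cycle_space_contract M Z X : cycle_space M Z -> X \subset ground M ->
  cycle_space (contract M X) [set C :\: X | C in Z].
Proof.
move=> cs sX; have [Z0 ZD gZ hI] := cs; split.
- by apply/imsetP; exists set0; rewrite ?set0D.
- move=> _ _ /imsetP[A AZ ->] /imsetP[B BZ ->]; apply/imsetP.
  exists (symdiff A B); first exact: ZD.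
  by apply/setP=> x; rewrite !inE; case: (x \in X).
- by move=> _ /imsetP[A AZ ->]; rewrite setSD ?gZ.
move=> I /= sI; rewrite inE sI /=.
have /subsetDP[sIg dIX] := sI.
split=> [/existsP[B /andP[bB iIB]] _ /imsetP[C CZ ->] sC|noC].
  (* Clearing moves [C] into [I :|: B] without changing its part off [X]. *)
  have [D DZ [eqD sD]] := cycle_space_clear cs sX bB CZ.
  have /maxsetP[/andP[sBX _] _] := bB.
  have sIB : I :|: B \subset ground M by rewrite subUset sIg (subset_trans sBX).
  rewrite -eqD ((hI _ sIB).1 iIB D DZ) ?set0D //.
  by rewrite -(setID D X) setUC setUSS // eqD.
have [|B bB _] := @maxset_exists _
    (fun D => (D \subset X) && (D \in indep M)) set0.
  by rewrite sub0set indep0.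
have /maxsetP[/andP[sBX iB] _] := bB.
have sBg := subset_trans sBX sX.
apply/existsP; exists B; rewrite /basis_in bB /=.
apply/hI; first by rewrite subUset sIg.
(* The part of [C] off [X] lies in [I], hence is empty, so [C] falls inside the independent set
   [B]. *)
move=> C CZ sC; apply: ((hI _ sBg).1 iB) => //.
have CX0 : C :\: X = set0.
  apply: noC; first exact: imset_f.
  apply/subsetP=> x /setDP[/(subsetP sC)/setUP[//|/(subsetP sBX) xX]].
  by rewrite xX.
apply/subsetP=> x xC; have /setUP[xI|//] := subsetP sC x xC.
move/setP/(_ x): CX0; rewrite !inE xC andbT => /negbFE xX.
by rewrite (disjointFr dIX xI) in xX.
Qed.

End CycleSpace.

(** * From a representation over ['F_2] to a cycle space *)

Section Binary.
Local Open Scope ring_scope.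

Lemma F2_bool (a : 'F_2) : a = (a != 0)%:R.
Proof. by case: a => [[|[|//]] lta]; apply/val_inj. Qed.

Lemma free_mapP (F : fieldType) (V : vectType F) (T : eqType) (v : T -> V)
    (s : seq T) : uniq s ->
  free [seq v x | x <- s] <->
  forall k : T -> F, \sum_(x <- s) k x *: v x = 0 ->
    forall x, x \in s -> k x = 0.
Proof.
move=> us; have szs : size [seq v x | x <- s] == size s by rewrite size_map.
have nthE (i : 'I_(size s)) x0 : [seq v x | x <- s]`_i = v (nth x0 s i).
  by rewrite (nth_map x0).
rewrite -[[seq v x | x <- s]]/(tval (Tuple szs)); split.
  move/freeP=> fr k k0 x xs.
  have ltx : (index x s < size s)%N by rewrite index_mem.
  have := fr (fun i => k (nth x s i)) _ (Ordinal ltx); rewrite /= nth_index //.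
  apply; rewrite -[RHS]k0 (big_nth x) big_mkord.
  by apply: eq_bigr => i _; rewrite (nthE i x).
move=> h; apply/freeP=> k k0 i.
have x0 : T by case: (s) i => [[]|].
(* Coefficients move from positions to elements; the default 0 is taken only outside [s]. *)
pose k' x := oapp k 0 (insub (index x s)).
have k'E (j : 'I_(size s)) : k' (nth x0 s j) = k j.
  by rewrite /k' index_uniq // valK.
rewrite -k'E; apply: h; last exact: mem_nth.
rewrite -[RHS]k0 (big_nth x0) big_mkord.
by apply: eq_bigr => j _; rewrite k'E (nthE j x0).
Qed.

(** Over ['F_2] a coefficient family is the indicator of its support, so linear relations are
    zero-sum subsets. *)
Lemma free_F2P (T : finType) (n : nat) (v : T -> 'rV['F_2]_n) (I : {set T}) :
  free [seq v x | x <- enum I] <->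
  (forall C : {set T}, C \subset I -> \sum_(x in C) v x = 0 -> C = set0).
Proof.
have sumE (k : T -> 'F_2) (C : {set T}) : C = [set x in I | k x != 0] ->
    \sum_(x in C) v x = \sum_(x <- enum I) k x *: v x.
  move->; rewrite big_enum /= big_mkcond [RHS]big_mkcond /=.
  apply: eq_bigr => x _; rewrite inE; case: (x \in I) => //=.
  by rewrite {2}[k x]F2_bool; case: (k x != 0); rewrite ?scale1r ?scale0r.
apply: iff_trans (free_mapP v (enum_uniq I)) _.
split=> [fr C sCI C0|h k k0 x].
  pose k x : 'F_2 := (x \in C)%:R.
  have CE : C = [set x in I | k x != 0].
    apply/setP=> x; rewrite inE /k; case: (boolP (x \in C)) => xC.
      by rewrite (subsetP sCI).
    by rewrite eqxx andbF.
  apply/eqP; rewrite -subset0; apply/subsetP=> x; rewrite CE inE => /andP[xI].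
  by rewrite (fr k) ?eqxx ?mem_enum // -(sumE k C).
rewrite mem_enum => xI; have /setP/(_ x) : [set x in I | k x != 0] = set0.
  apply: h; last by rewrite (sumE k).
  by apply/subsetP=> y; rewrite inE => /andP[].
by rewrite !inE xI /= => /negbFE/eqP.
Qed.

Lemma binary_cycle_space (T : finType) (M : matroid T) :
  binary M -> exists Z, cycle_space M Z.
Proof.
case=> n [v indE].
exists [set C : {set T} | (C \subset ground M) && (\sum_(x in C) v x == 0)].
split.
- by rewrite inE sub0set big_set0 eqxx.
- move=> A B; rewrite !inE => /andP[sA /eqP A0] /andP[sB /eqP B0].
  apply/andP; split.
    apply/subsetP=> x; rewrite inE; have [/(subsetP sA) //|_] := boolP (x \in A).
    by move/(subsetP sB).
  suff -> : \sum_(x in symdiff A B) v x = \sum_(x in A) v x + \sum_(x in B) v x.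
    by rewrite A0 B0 addr0.
  rewrite big_mkcond [X in _ = X + _]big_mkcond [X in _ = _ + X]big_mkcond.
  rewrite -big_split /=.
  apply: eq_bigr => x _; rewrite inE.
  case: (x \in A) (x \in B) => [] []; rewrite ?addr0 ?add0r //.
  (* An element of both sets is counted twice, which vanishes in characteristic 2. *)
  by rewrite -mulr2n -scaler_nat (_ : 2%:R = 0) ?scale0r //; apply/val_inj.
- by move=> A; rewrite inE => /andP[].
move=> I sI; rewrite indE //; apply: iff_trans (free_F2P v I) _.
split=> h C; first by rewrite inE => /andP[_ /eqP C0] sC; apply: h.
by move=> sC C0; apply: h; rewrite // inE C0 eqxx (subset_trans sC).
Qed.

End Binary.

(** * The lift and the projection *)

(** Each coordinate of the image vector is a fixed coordinate of the source or constantly 0, so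
    equal sums stay equal. *)
Lemma preserves_relations_coord (T : finType) (M N : matroid T)
    (f : Cyc M -> Cyc N) (h : T -> option T) :
    (forall C x, (x \in val (f C)) = oapp [in val C] false (h x)) ->
  preserves_relations f.
Proof.
move=> fE d C D _ /ffunP eqCD; apply/ffunP=> x; rewrite !sum_ffunE.
case hx: (h x) => [y|]; last first.
  by apply: eq_bigr => i _; rewrite !ffunE !fE hx.
have toy (A : 'I_d -> Cyc M) :
    (\sum_(i < d) charv (val (f (A i))) x = \sum_(i < d) charv (val (A i)) y)%R.
  by apply: eq_bigr => i _; rewrite !ffunE fE hx.
by rewrite !toy; move: (eqCD y); rewrite !sum_ffunE.
Qed.

(** The bit [b] records complementation; over disjoint circuits both traces, and hence these bits,
    add modulo 2. *)
Lemma retract_pair_cycle (T : finType) (M : matroid T) s (e e' : 'I_s -> T) C :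
    retract_pair M e e' -> cycle M C ->
  exists b, forall i, (e i \in C) = b (+) (e' i \in C).
Proof.
case=> [[_ eI e'I] [_ _ dis] cE' h].
elim/cycle_ind: C / => [|C K cC [b bK] dCK].
  by exists false => i; rewrite !inE.
suff [c cC'] : exists c, forall i, (e i \in C) = c (+) (e' i \in C).
  by exists (c (+) b) => i; rewrite !disjoint_in_setU // cC' bK addbACA.
have inE0 i : e i \in e @: setT by apply: imset_f.
have inE' i : e' i \in e' @: setT by apply: imset_f.
(* The hypothesis covers only proper index sets. If [C] contains the circuit E', minimality gives
   [C] = E', whose trace on E is empty. *)
have [sE'C|nsE'C] := boolP (e' @: setT \subset C).
  exists true => i; rewrite (subsetP sE'C (e' i)) //= -(circuit_min cC cE' sE'C).
  exact: disjointFr dis _.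
pose I := [set i | e' i \in C].
have CI : C :&: e' @: setT = e' @: I.
  apply/setP=> y; apply/setIP/imsetP=> [[yC /imsetP[i _ yi]]|[i]].
    by exists i; rewrite ?inE -?yi.
  by rewrite inE => iC ->.
have ltI : #|I| < s.
  rewrite ltnNge -{1}[s]card_ord -cardsT; apply: contra nsE'C => leI.
  have /eqP IT : I == setT by rewrite eqEcard subsetT.
  apply/subsetP=> _ /imsetP[i _ ->].
  by have := in_setT i; rewrite -IT inE.
case: (h C I cC ltI CI) => /setP eqC; [exists false|exists true] => i.
  by have := eqC (e i); rewrite !inE inE0 andbT mem_imset // inE.
by have := eqC (e i); rewrite !inE inE0 !andbT mem_imset // inE addTb.
Qed.

Theorem theorem4p13 (T : finType) (M M' : matroid T)
    (nfM : nonfree M) (nfM' : nonfree M') :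
  binary M -> binary_matroidal_retract M M' -> matroidal_retract M M'.
Proof.
move=> /binary_cycle_space[Z cs] [s [e [e' [rp ->]]]].
have [[_ _ e'I] [_ sE' dis] cE' _] := rp.
set E' := e' @: setT in sE' dis cE' *.
have cs' := cycle_space_contract cs sE'.
have [_ ZD _ _] := cs.
have E'Z : E' \in Z.
  move: cE'; rewrite (circuit_cycle_space _ cs).
  by case/minsetP=> /andP[].
(* Preimage under [h] copies the trace on E to E' and leaves all other elements alone. *)
pose h x := if [pick i | e' i == x] is Some i then e i else x.
have hE' i : h (e' i) = e i.
  by rewrite /h; case: pickP => [j /eqP/e'I->|/(_ i)]; rewrite ?eqxx.
have hN x : x \notin E' -> h x = x.
  by rewrite /h; case: pickP => // i /eqP<-; rewrite imset_f.
have eN i : e i \notin E' by rewrite (disjointFr dis) ?imset_f.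
have inE' i : e' i \in E' by apply: imset_f.
have liftP D : cycle (contract M E') D -> cycle M (h @^-1: D).
  rewrite (cycle_in_cycle_space _ cs') => /imsetP[C CZ ->].
  rewrite (cycle_in_cycle_space _ cs).
  have cC : cycle M C by rewrite (cycle_in_cycle_space _ cs).
  have [b bC] := retract_pair_cycle rp cC.
  (* When [b] holds the trace of [C] on E' is the complement of the desired one, and adding the
     circuit [E'] corrects it. *)
  suff -> : h @^-1: (C :\: E') = if b then symdiff C E' else C.
    by case: b {bC} => //; apply: ZD.
  apply/setP=> x; rewrite !inE.
  have [/imsetP[i _ ->]|xE'] := boolP (x \in E').
    by rewrite hE' eN bC; case: b {bC}; rewrite //= inE inE' addbT.
  by rewrite hN // xE'; case: b {bC}; rewrite //= inE (negPf xE') addbF.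
have projP C : cycle M C -> cycle (contract M E') (C :\: E').
  rewrite (cycle_in_cycle_space _ cs) (cycle_in_cycle_space _ cs').
  exact: imset_f.
split; first by rewrite subsetDl.
exists (fun D : Cyc (contract M E') =>
  exist (fun A => cycle M A) _ (liftP _ (valP D))).
exists (fun C : Cyc M =>
  exist (fun A => cycle (contract M E') A) _ (projP _ (valP C))).
split.
(* Off [E'] the map [h] is the identity; on [E'] both sides are false, since [D] misses [E']. *)
- move=> D; apply/val_inj/setP=> x; rewrite /= !inE.
  have [xE'|/hN->//] := boolP (x \in E').
  have := valP D; rewrite /= (cycle_in_cycle_space _ cs') => /imsetP[C _ ->].
  by rewrite inE xE'.
- apply: (preserves_relations_coord (h := fun x => Some (h x))) => D x.
  by rewrite /= inE.
- apply: (preserves_relations_coord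
    (h := fun x => if x \in E' then None else Some x)) => C x.
  by rewrite /= inE; case: ifP.
Qed.
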